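(* Let $A$ be a totally definite quaternion algebra over a totally real number field $K$ of degree $n=[K:\mathbb{Q}]$, let $\Lambda$ be an $\mathcal{O}_K$-order of $A$, and suppose that $\Lambda^1$ is isomorphic to the binary dihedral group of order $4m$ for some $m>1$. Then $\Lambda^1$ contains a $\mathbb{Q}$-basis for $A$ if and only if $K$ is the maximal real subfield of $\mathbb{Q}(\zeta_{2m})$, i.e., $\varphi(2m)=2n$.
   Context: A quaternion algebra over a number field $K$ is $A=\left(\frac{a,b}{K}\right)=K\oplus Ki\oplus Kj\oplus Kij$ with $i^2=a$, $j^2=b$, $ij=-ji$, $a,b\in K^\times$. It is totally definite if $A\otimes_{\mathbb{Q}}\mathbb{R}\cong\mathbb{H}^n$, where $n=[K:\mathbb{Q}]$ and $\mathbb{H}$ denotes the Hamilton quaternions. For $x=x_0+x_1i+x_2j+x_3ij$, the conjugate is $\overline{x}=x_0-x_1i-x_2j-x_3ij$ and the reduced norm is $n_{A/K}(x)=x\overline{x}\in K$. $\mathcal{O}_K$ is the ring of integers of $K$. An $\mathcal{O}_K$-order $\Lambda$ of $A$ is a subring of $A$ containing $1$ that is a finitely generated $\mathcal{O}_K$-module containing a $K$-basis of $A$. Its reduced norm one group is $\Lambda^1=\{x\in\Lambda : n_{A/K}(x)=1\}$. The binary dihedral group of order $4m$ is $\langle x,y\mid y^{2m}=1,\ x^2=y^m,\ xyx^{-1}=y^{-1}\rangle$. $\varphi$ is Euler's totient function, $\zeta_{2m}$ is a primitive $2m$-th root of unity, and the maximal real subfield of $\mathbb{Q}(\zeta_{2m})$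 is $\mathbb{Q}(\zeta_{2m}+\zeta_{2m}^{-1})$; equality of the abstract number field $K$ with it is understood as isomorphism of fields. *)

(* Defs.v *)
From HB Require Import structures.
From mathcomp Require Import all_boot all_order all_algebra.
From mathcomp Require Import all_fingroup all_solvable all_field.
From mathcomp Require Import reals.
From mathcomp Require Import complex.
From mathcomp Require Import ring.

Set Implicit Arguments.
Unset Strict Implicit.
Unset Printing Implicit Defensive.

Import Order.TTheory GRing.Theory Num.Theory.
Local Open Scope ring_scope.

(* The quaternion algebra (a, b / F): [Quat a b x0 x1 x2 x3] stands for
   x0 + x1 i + x2 j + x3 ij, where i^2 = a, j^2 = b and ij = - ji. *)
Record quat (F : fieldType) (a b : F) : Type :=
  Quat { q0 : F; q1 : F; q2 : F; q3 : F }.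

Section Quaternion.
Variables (F : fieldType) (a b : F).
Local Notation Q := (quat a b).
Local Notation Quat := (Quat a b).

Definition q_pack (x : F * F * F * F) : Q :=
  Quat x.1.1.1 x.1.1.2 x.1.2 x.2.
Definition q_unpack (x : Q) : F * F * F * F := (q0 x, q1 x, q2 x, q3 x).

Fact q_unpackK : cancel q_unpack q_pack. Proof. by case. Qed.

HB.instance Definition _ := Choice.copy Q (can_type q_unpackK).

Definition q_add (x y : Q) : Q :=
  Quat (q0 x + q0 y) (q1 x + q1 y) (q2 x + q2 y) (q3 x + q3 y).
Definition q_opp (x : Q) : Q := Quat (- q0 x) (- q1 x) (- q2 x) (- q3 x).
Definition q_zero : Q := Quat 0 0 0 0.

Fact q_addA : associative q_add.
Proof. by move=> x y z; congr Quat; apply: addrA. Qed.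
Fact q_addC : commutative q_add.
Proof. by move=> x y; congr Quat; apply: addrC. Qed.
Fact q_add0 : left_id q_zero q_add.
Proof. by case=> *; congr Quat; apply: add0r. Qed.
Fact q_addN : left_inverse q_zero q_opp q_add.
Proof. by move=> x; congr Quat; apply: addNr. Qed.

HB.instance Definition _ := GRing.isZmodule.Build Q q_addA q_addC q_add0 q_addN.

Definition q_mul (x y : Q) : Q :=
  let: {| q0 := x0; q1 := x1; q2 := x2; q3 := x3 |} := x in
  let: {| q0 := y0; q1 := y1; q2 := y2; q3 := y3 |} := y in
  Quat (x0 * y0 + a * (x1 * y1) + b * (x2 * y2) - a * b * (x3 * y3))
       (x0 * y1 + x1 * y0 - b * (x2 * y3) + b * (x3 * y2))
       (x0 * y2 + x2 * y0 + a * (x1 * y3) - a * (x3 * y1))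
       (x0 * y3 + x3 * y0 + x1 * y2 - x2 * y1).

Fact q_mulA : associative q_mul.
Proof. by case=> ? ? ? ? [? ? ? ?] [? ? ? ?]; congr Quat; ring. Qed.
Fact q_mul1l : left_id (Quat 1 0 0 0) q_mul.
Proof. by case=> *; congr Quat; ring. Qed.
Fact q_mul1r : right_id (Quat 1 0 0 0) q_mul.
Proof. by case=> *; congr Quat; ring. Qed.
Fact q_mulDl : left_distributive q_mul q_add.
Proof. by case=> ? ? ? ? [? ? ? ?] [? ? ? ?]; congr Quat; rewrite /=; ring. Qed.
Fact q_mulDr : right_distributive q_mul q_add.
Proof. by case=> ? ? ? ? [? ? ? ?] [? ? ? ?]; congr Quat; rewrite /=; ring. Qed.
Fact q_one_neq0 : Quat 1 0 0 0 != 0.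
Proof. by apply/eqP => -[/eqP]; rewrite oner_eq0. Qed.

HB.instance Definition _ := GRing.Zmodule_isNzRing.Build Q
  q_mulA q_mul1l q_mul1r q_mulDl q_mulDr q_one_neq0.

Definition q_scale (c : F) (x : Q) : Q :=
  Quat (c * q0 x) (c * q1 x) (c * q2 x) (c * q3 x).

Fact q_scaleA c d x : q_scale c (q_scale d x) = q_scale (c * d) x.
Proof. by congr Quat; apply: mulrA. Qed.
Fact q_scale1 : left_id 1 q_scale.
Proof. by case=> *; congr Quat; apply: mul1r. Qed.
Fact q_scaleDr : right_distributive q_scale +%R.
Proof. by move=> c x y; congr Quat; apply: mulrDr. Qed.
Fact q_scaleDl x : {morph q_scale^~ x : c d / c + d}.
Proof. by move=> c d; congr Quat; apply: mulrDl. Qed.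

HB.instance Definition _ := GRing.Zmodule_isLmodule.Build F Q
  q_scaleA q_scale1 q_scaleDr q_scaleDl.

Fact q_scaleAl (c : F) (x y : Q) : c *: (x * y) = (c *: x) * y.
Proof. by case: x y => ? ? ? ? [? ? ? ?]; congr Quat; rewrite /=; ring. Qed.

HB.instance Definition _ := GRing.Lmodule_isLalgebra.Build F Q q_scaleAl.

Fact q_scaleAr (c : F) (x y : Q) : c *: (x * y) = x * (c *: y).
Proof. by case: x y => ? ? ? ? [? ? ? ?]; congr Quat; rewrite /=; ring. Qed.

HB.instance Definition _ := GRing.Lalgebra_isAlgebra.Build F Q q_scaleAr.

Fact q_vect_iso : Vector.axiom 4 Q.
Proof.
exists (fun x : Q => \row_i [:: q0 x; q1 x; q2 x; q3 x]`_i).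
  by move=> c x y; apply/rowP => -[[|[|[|[|]]]] //= ?]; rewrite !mxE.
exists (fun u : 'rV_4 => Quat (u 0 0) (u 0 1) (u 0 2%:R) (u 0 3%:R)).
  by case=> *; rewrite !mxE.
move=> u; apply/rowP => -[[|[|[|[|]]]] //= lti]; rewrite !mxE /=;
  by congr (u _ _); apply: val_inj.
Qed.

HB.instance Definition _ := Lmodule_hasFinDim.Build F Q q_vect_iso.
HB.instance Definition _ := Algebra_isFalgebra.Build F Q.

Definition q_conj (x : Q) : Q := Quat (q0 x) (- q1 x) (- q2 x) (- q3 x).

(* x * q_conj x is a scalar (see q_mul_conj); the norm is that scalar. *)
Definition q_norm (x : Q) : F := q0 (x * q_conj x).

Lemma q_mul_conj (x : Q) : x * q_conj x = (q_norm x)%:A.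
Proof. by case: x => ? ? ? ?; congr Quat; rewrite /q_norm /=; ring. Qed.

Lemma q_basisE x0 x1 x2 x3 :
  let i := Quat 0 1 0 0 in let j := Quat 0 0 1 0 in
  Quat x0 x1 x2 x3 = x0%:A + x1 *: i + x2 *: j + x3 *: (i * j).
Proof. by congr Quat; rewrite /=; ring. Qed.

Lemma q_relations : let i := Quat 0 1 0 0 in let j := Quat 0 0 1 0 in
  [/\ i * i = a%:A, j * j = b%:A & i * j = - (j * i)].
Proof. by split; congr Quat; rewrite /=; ring. Qed.

End Quaternion.

Definition hamilton (F : fieldType) : falgType F := quat (-1 : F) (-1).

(* Restriction of scalars: a finite-dimensional K-algebra A viewed as an
   F-algebra, for a finite field extension K / F. *)
Definition restr (F : fieldType) (K : fieldExtType F) (A : falgType K) : Type :=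
  A.

Section RestrictionOfScalars.
Variables (F : fieldType) (K : fieldExtType F) (A : falgType K).
Local Notation B := (restr A).

HB.instance Definition _ := GRing.UnitRing.copy B A.

Definition restr_scale (c : F) (x : B) : B := (c%:A : K) *: (x : A).

Fact restr_scaleA c d x :
  restr_scale c (restr_scale d x) = restr_scale (c * d) x.
Proof. by rewrite /restr_scale scalerA -scalerAl mul1r scalerA. Qed.

Fact restr_scale1 : left_id 1 restr_scale.
Proof. by move=> x; rewrite /restr_scale !scale1r. Qed.

Fact restr_scaleDr : right_distributive restr_scale +%R.
Proof. by move=> c x y; rewrite /restr_scale scalerDr. Qed.

Fact restr_scaleDl x : {morph restr_scale^~ x : c d / c + d}.
Proof. by move=> c d; rewrite /restr_scale !scalerDl. Qed.

HB.instance Definition _ := GRing.Zmodule_isLmodule.Build F B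
  restr_scaleA restr_scale1 restr_scaleDr restr_scaleDl.

Fact restr_scaleAl (c : F) (x y : B) : c *: (x * y) = (c *: x) * y.
Proof. exact: (@scalerAl K A). Qed.

HB.instance Definition _ := GRing.Lmodule_isLalgebra.Build F B restr_scaleAl.

Fact restr_scaleAr (c : F) (x y : B) : c *: (x * y) = x * (c *: y).
Proof. exact: (@scalerAr K A). Qed.

HB.instance Definition _ := GRing.Lalgebra_isAlgebra.Build F B restr_scaleAr.

Import VectorInternalTheory.

Fact restr_vect_iso : Vector.axiom (dim A * dim K) B.
Proof.
pose M2B (M : 'M[F]_(dim A, dim K)) : B :=
  (r2v (\row_i (r2v (row i M) : K)) : A).
pose B2M (x : B) : 'M[F]_(dim A, dim K) :=
  \matrix_(i, j) (v2r ((v2r (x : A)) 0 i : K)) 0 j.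
exists (fun x => mxvec (B2M x)).
  move=> c x y; rewrite -linearP; congr mxvec; apply/matrixP => i j.
  rewrite !mxE.
  have -> : v2r (c *: x + y : A) = (c%:A : K) *: v2r (x : A) + v2r (y : A).
    exact: (@linearP _ _ _ _ (v2r : {linear A -> _})).
  by rewrite !mxE mulr_algl linearP !mxE.
exists (fun r => M2B (vec_mx r)) => [x|r].
  rewrite mxvecK /M2B -[RHS](v2rK (x : A)); congr r2v.
  apply/rowP => i; rewrite mxE -[RHS](v2rK); congr r2v.
  by apply/rowP => j; rewrite !mxE.
apply/(canLR vec_mxK)/matrixP => i j.
by rewrite mxE /M2B r2vK mxE r2vK mxE.
Qed.

HB.instance Definition _ := Lmodule_hasFinDim.Build F B restr_vect_iso.

End RestrictionOfScalars.

(* Extension of scalars: the E-algebra A (x)_F E for a finite-dimensional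
   F-algebra A and a field morphism f : F -> E.  With (e_i)_i the F-basis
   vbasis {:A} of A, the row vector u stands for \sum_i e_i (x) u_i. *)
Definition ext (F E : fieldType) (f : {rmorphism F -> E}) (A : falgType F) :
  Type := 'rV[E]_(\dim {:A}).

Section ExtensionOfScalars.
Variables (F E : fieldType) (f : {rmorphism F -> E}) (A : falgType F).
Local Notation T := (ext f A).
Local Notation e := (vbasis {:A}).

HB.instance Definition _ := Vector.copy T 'rV[E]_(\dim {:A}).

(* x |-> x (x) 1 *)
Definition ext_in (x : A) : T := \row_k f (coord e k x).

Definition ext_mul (u v : T) : T :=
  \sum_i \sum_j (u 0 i * v 0 j) *: ext_in (e`_i * e`_j).

Fact ext_in_sum (I : Type) (r : seq I) (c : I -> F) (x : I -> A) :
  ext_in (\sum_(i <- r) c i *: x i) = \sum_(i <- r) f (c i) *: ext_in (x i).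
Proof.
apply/rowP => k; rewrite !mxE linear_sum rmorph_sum summxE.
by apply: eq_bigr => i _; rewrite linearZ rmorphM !mxE.
Qed.

Fact ext_coord (x : A) : x = \sum_i coord e i x *: e`_i.
Proof. exact/coord_vbasis/memvf. Qed.

Fact ext_inE (x : A) i : ext_in x 0 i = f (coord e i x).
Proof. by rewrite mxE. Qed.

Fact ext_dec (u : T) : u = \sum_i u 0 i *: ext_in e`_i.
Proof.
apply/rowP => k; rewrite summxE (bigD1 k) //= !mxE.
rewrite coord_free ?(basis_free (vbasisP _)) // eqxx rmorph1 mulr1.
rewrite big1 ?addr0 // => i /negPf ki; rewrite !mxE.
by rewrite coord_free ?(basis_free (vbasisP _)) // ki rmorph0 mulr0.
Qed.

Fact ext_mulDl : left_distributive ext_mul +%R.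
Proof.
move=> u v w; rewrite /ext_mul -big_split; apply: eq_bigr => i _ /=.
rewrite -big_split; apply: eq_bigr => j _ /=.
by rewrite !mxE mulrDl scalerDl.
Qed.

Fact ext_mulDr : right_distributive ext_mul +%R.
Proof.
move=> u v w; rewrite /ext_mul -big_split; apply: eq_bigr => i _ /=.
rewrite -big_split; apply: eq_bigr => j _ /=.
by rewrite !mxE mulrDr scalerDl.
Qed.

Fact ext_scaleAl (c : E) (u v : T) : c *: ext_mul u v = ext_mul (c *: u) v.
Proof.
rewrite /ext_mul scaler_sumr; apply: eq_bigr => i _ /=.
rewrite scaler_sumr; apply: eq_bigr => j _ /=.
by rewrite scalerA mulrA mxE.
Qed.

Fact ext_scaleAr (c : E) (u v : T) : c *: ext_mul u v = ext_mul u (c *: v).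
Proof.
rewrite /ext_mul scaler_sumr; apply: eq_bigr => i _ /=.
rewrite scaler_sumr; apply: eq_bigr => j _ /=.
by rewrite scalerA mulrCA mxE.
Qed.

Fact ext_inM (x y : A) : ext_mul (ext_in x) (ext_in y) = ext_in (x * y).
Proof.
rewrite [in RHS](ext_coord x) [in RHS](ext_coord y) mulr_suml.
under [in RHS]eq_bigr do rewrite -scalerAl mulr_sumr.
rewrite ext_in_sum /ext_mul; apply: eq_bigr => i _.
under [in RHS]eq_bigr do rewrite -scalerAr.
rewrite ext_in_sum scaler_sumr; apply: eq_bigr => j _.
by rewrite scalerA !ext_inE.
Qed.

Fact ext_mul_suml (I : Type) (r : seq I) (x : I -> T) (v : T) :
  ext_mul (\sum_(i <- r) x i) v = \sum_(i <- r) ext_mul (x i) v.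
Proof.
elim: r => [|i r IHr]; last by rewrite !big_cons ext_mulDl IHr.
rewrite !big_nil -[0 in LHS](scale0r (0 : T)) -ext_scaleAl.
by rewrite scale0r.
Qed.

Fact ext_mul_sumr (I : Type) (r : seq I) (x : I -> T) (v : T) :
  ext_mul v (\sum_(i <- r) x i) = \sum_(i <- r) ext_mul v (x i).
Proof.
elim: r => [|i r IHr]; last by rewrite !big_cons ext_mulDr IHr.
rewrite !big_nil -[0 in LHS](scale0r (0 : T)) -ext_scaleAr.
by rewrite scale0r.
Qed.

Fact ext_mul_decl (u v : T) :
  ext_mul u v = \sum_i u 0 i *: ext_mul (ext_in e`_i) v.
Proof.
rewrite [in LHS](ext_dec u) (ext_mul_suml (index_enum _)).
by apply: eq_bigr => i _; rewrite ext_scaleAl.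
Qed.

Fact ext_mul_decr (u v : T) :
  ext_mul u v = \sum_i v 0 i *: ext_mul u (ext_in e`_i).
Proof.
rewrite [in LHS](ext_dec v) (ext_mul_sumr (index_enum _)).
by apply: eq_bigr => i _; rewrite ext_scaleAr.
Qed.

Fact ext_mulA : associative ext_mul.
Proof.
move=> u v w; rewrite [LHS]ext_mul_decl (ext_mul_decl u v).
rewrite [RHS](ext_mul_suml (index_enum _)); apply: eq_bigr => i _.
rewrite -[RHS]ext_scaleAl; congr (_ *: (_ : T)).
rewrite (ext_mul_decl v w) (ext_mul_decr _ v) [LHS](ext_mul_sumr (index_enum _)).
rewrite [RHS](ext_mul_suml (index_enum _)); apply: eq_bigr => j _.
rewrite -[RHS]ext_scaleAl -[LHS]ext_scaleAr; congr (_ *: (_ : T)).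
rewrite (ext_mul_decr _ w) [RHS]ext_mul_decr.
rewrite [LHS](ext_mul_sumr (index_enum _)); apply: eq_bigr => k _.
by rewrite -[LHS]ext_scaleAr !ext_inM mulrA.
Qed.

Fact ext_mul1l : left_id (ext_in 1) ext_mul.
Proof.
move=> u; rewrite [LHS]ext_mul_decr [RHS]ext_dec.
by apply: eq_bigr => i _; rewrite ext_inM mul1r.
Qed.

Fact ext_mul1r : right_id (ext_in 1) ext_mul.
Proof.
move=> u; rewrite [LHS]ext_mul_decl [RHS]ext_dec.
by apply: eq_bigr => i _; rewrite ext_inM mulr1.
Qed.

Fact ext_one_neq0 : ext_in 1 != 0.
Proof.
apply/eqP => /rowP h; have /eqP[] := oner_neq0 A.
rewrite [LHS]ext_coord big1 // => i _.
by have /eqP := h i; rewrite !mxE fmorph_eq0 => /eqP ->; rewrite scale0r.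
Qed.

HB.instance Definition _ := GRing.Zmodule_isNzRing.Build T
  ext_mulA ext_mul1l ext_mul1r ext_mulDl ext_mulDr ext_one_neq0.
HB.instance Definition _ := GRing.Lmodule_isLalgebra.Build E T ext_scaleAl.
HB.instance Definition _ := GRing.Lalgebra_isAlgebra.Build E T ext_scaleAr.
HB.instance Definition _ := Algebra_isFalgebra.Build E T.

End ExtensionOfScalars.

Definition totally_real (R : realType) (K : fieldExtType rat) : Prop :=
  forall (f : {rmorphism K -> R[i]}) (x : K), f x \is Num.real.

(* A (x)_Q R is isomorphic to H^n as an R-algebra, n = [K : Q]. *)
Definition totally_definite (R : realType) (K : fieldExtType rat)
    (A : falgType K) : Prop :=
  exists f : {lrmorphism ext (ratr : rat -> R) (restr A) ->
                         {ffun 'I_(\dim {:K}) -> hamilton R}},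
    bijective f.

Definition ring_of_integers (K : fieldExtType rat) (x : K) : Prop :=
  integralOver (intr : int -> K) x.

(* [subring_closed] includes 1 \in L; the second clause says that L is the
   O_K-submodule generated by the finite family g. *)
Definition is_order (K : fieldExtType rat) (A : falgType K) (L : {pred A}) :
    Prop :=
  [/\ subring_closed L,
      exists (r : nat) (g : 'I_r -> A), forall x : A, x \in L <->
        exists2 c : 'I_r -> K, (forall i, ring_of_integers (c i)) &
                               x = \sum_i c i *: g i
    & exists2 X : seq A, basis_of {:A} X & {subset X <= L}].

Definition norm_one (K : fieldType) (a b : K) (L : {pred quat a b}) :
    {pred quat a b} :=
  [pred x | (x \in L) && (q_norm x == 1)].

(* The group presented by these relations is finite (of order 4m), so that
   [\isog Grp] is isomorphism with it. *)
Definition binary_dihedral (m : nat) (gT : finGroupType) (G : {group gT}) :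
    Prop :=
  (G \isog Grp (x : y : y ^+ (2 * m) = 1, x ^+ 2 = y ^+ m,
                        x * y * x^-1 = y^-1))%g.

(* The set S, with the multiplication of A, is a group isomorphic to G. *)
Definition mul_isog (A : nzRingType) (S : {pred A})
    (gT : finGroupType) (G : {group gT}) : Prop :=
  exists f : gT -> A,
    [/\ {in G &, {morph f : x y / (x * y)%g >-> x * y}},
        {in G &, injective f}
      & forall x : A, x \in S <-> exists2 g, g \in G & f g = x].

Definition contains_rat_basis (K : fieldExtType rat) (A : falgType K)
    (S : {pred A}) : Prop :=
  exists2 X : seq (restr A), basis_of {:restr A} X &
    forall x : A, x \in (X : seq A) -> x \in S.

Definition field_isomorphic (K L : fieldType) : Prop :=
  exists f : {rmorphism K -> L}, bijective f.

(* Main.v *)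
(* Let x, y generate Lam^1, with y of order n = 2m and x y x^-1 = y^-1.  As y
   has reduced norm 1 it satisfies y^2 = t y - 1 with t = y + y^-1 in K, and
   this forces Phi_n(y) = 0.  Hence zeta |-> y embeds Q(zeta) in A, and
   w = zeta + zeta^-1 |-> t embeds Q(w) in K, so that phi(n) / 2 = [Q(w) : Q]
   is at most [K : Q], and K is isomorphic to Q(w) exactly when the degrees
   agree.  The rational span of Lam^1 is Q(y) + x Q(y), of dimension at most
   2 phi(n), which must be 4 [K : Q] if it is all of A.  Conversely, if
   K = Q(t), this span is stable under K and contains 1, y, x, x y; these are
   independent over K, because p + x q = 0 with p, q in K(y) gives, by
   commuting with y, x (y^-1 - y) q = 0 with y^-1 - y invertible. *)
Require Import Defs.
From HB Require Import structures.
From mathcomp Require Import all_boot all_order all_algebra.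
From mathcomp Require Import all_fingroup all_solvable all_field.
From mathcomp Require Import reals.
From mathcomp Require Import zify ring.
Set Implicit Arguments.
Unset Strict Implicit.
Unset Printing Implicit Defensive.
Import Order.TTheory GRing.Theory Num.Theory.
Local Open Scope ring_scope.

(** * Cyclotomic polynomials *)

(** The image of ['Phi_n] is the minimal polynomial over the rationals of a primitive root [z] in
    [algC]. In a factorization [r * q], one factor vanishes at [z] and is therefore divisible by the
    product: if it is [q], then [q] is associate to the product; if it is [r], the sizes contradict
    that [q] is nonconstant. *)
Lemma irreducible_Cyclotomic n :
  (0 < n)%N -> irreducible_poly (map_poly (intr : int -> rat) 'Phi_n).
Proof.
move=> n_gt0; have [z z_prim] := C_prim_root_exists n_gt0.
have [p [Dp _] pP] := minCpolyP z.
have DPhi: p = map_poly intr 'Phi_n.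
  apply: (map_poly_inj (ratr : {rmorphism rat -> algC})).
  rewrite -map_poly_comp -Dp (minCpoly_cyclotomic z_prim).
  rewrite -(Cintr_Cyclotomic z_prim).
  by apply: eq_map_poly => c; rewrite /= ratr_int.
rewrite -DPhi; split=> [|q q_neq1 /dvdpP[r Dpr]].
  rewrite DPhi size_map_inj_poly ?rmorph0 //; last exact: intr_inj.
  by rewrite size_Cyclotomic ltnS totient_gt0.
have p_neq0: p != 0.
  by have := minCpoly_monic z; rewrite Dp monicE; apply: contraTneq => ->;
     rewrite rmorph0 lead_coef0 eq_sym oner_eq0.
have q_neq0: q != 0 by apply: contraNneq p_neq0 => q0; rewrite Dpr q0 mulr0.
have r_neq0: r != 0 by apply: contraNneq p_neq0 => r0; rewrite Dpr r0 mul0r.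
have size_p: size p = (size r + size q).-1 by rewrite Dpr size_mul.
have: root (map_poly ratr p : {poly algC}) z by rewrite pP dvdpp.
rewrite {1}Dpr rmorphM rootM !pP => /orP[/dvdp_leq|pq]; last first.
  by rewrite /eqp pq andbT Dpr dvdp_mull.
move=> /(_ r_neq0); rewrite size_p.
move: q_neq1 q_neq0 r_neq0; rewrite -!size_poly_gt0.
case: (size q) => [|[|k]] // _ _; case: (size r) => // j _.
by rewrite !addnS /= ltnNge leq_addr.
Qed.

Lemma prod_Cyclotomic_map (R : comNzRingType) n :
    (0 < n)%N ->
  \prod_(d <- divisors n) map_poly (intr : int -> R) 'Phi_d = 'X^n - 1.
Proof.
move=> n_gt0; rewrite -rmorph_prod prod_Cyclotomic //.
by rewrite rmorphB rmorphXn /= map_polyX rmorph1.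
Qed.

Lemma Cyclotomic_dvdp (F : fieldType) n d :
  (0 < n)%N -> (d %| n)%N -> map_poly (intr : int -> F) 'Phi_d %| 'X^n - 1.
Proof.
move=> n_gt0 dn; rewrite -prod_Cyclotomic_map // (big_rem d) ?dvdp_mulr //=.
by rewrite -dvdn_divisors.
Qed.

(** As a root of ['X^n - 1], [u] is a root of some ['Phi_d] with [d] dividing [n]. Then
    [u ^+ d = 1], so [n] divides [d] and the two agree. *)
Lemma prim_root_Cyclotomic (F : fieldType) n (u : F) :
  n.-primitive_root u -> root (map_poly intr 'Phi_n) u.
Proof.
move=> u_prim; have n_gt0 := prim_order_gt0 u_prim.
have: root (\prod_(d <- divisors n) map_poly (intr : int -> F) 'Phi_d) u.
  rewrite prod_Cyclotomic_map // rootE !hornerE (prim_expr_order u_prim).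
  by rewrite subrr.
rewrite rootE horner_prod prodf_seq_eq0 => /hasP[d].
rewrite -dvdn_divisors // => dn /= root_d.
have d_gt0 := dvdn_gt0 n_gt0 dn.
have: root ('X^d - 1) u.
  rewrite -dvdp_XsubCl; apply: dvdp_trans (Cyclotomic_dvdp F d_gt0 (dvdnn d)).
  by rewrite dvdp_XsubCl.
rewrite rootE !hornerE subr_eq0 -(prim_order_dvd u_prim) => nd.
by have /eqP <-: d == n by rewrite eqn_dvd dn nd.
Qed.

(** * Morphisms out of a simple field extension *)

Section AlgebraGenerator.
Variables (F : fieldType) (L : fieldExtType F) (z : L).

Lemma horner_algE (B : algType F) (y : B) (p : {poly F}) :
  horner_alg y p = \sum_(i < size p) p`_i *: y ^+ i.
Proof.
rewrite /horner_alg /horner_morph horner_coef size_map_poly.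
by apply: eq_bigr => i _; rewrite coef_map /= mulr_algl.
Qed.

Lemma Fadjoin1P (x : L) :
  reflect (exists p : {poly F}, x = horner_alg z p) (x \in <<1; z>>%VS).
Proof.
apply: (iffP Fadjoin_polyP) => [[q /polyOver1P[p ->] ->] | [p ->]].
  by exists p.
by exists (map_poly (in_alg L) p) => //; apply/polyOver1P; exists p.
Qed.

(* The relations satisfied by z are the multiples of the irreducible p, so
   sending z to any root of p is well defined. *)
Lemma generator_lift (p : {poly F}) (B : algType F) (y : B) :
    <<1; z>>%VS = {:L}%VS -> irreducible_poly p ->
    horner_alg z p = 0 -> horner_alg y p = 0 ->
  exists s : {rmorphism L -> B}, forall q, s (horner_alg z q) = horner_alg y q.
Proof.
move=> L_gen p_irr pz py.
have vanish q : horner_alg z q = 0 -> horner_alg y q = 0.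
  move=> qz; have /dvdpP[r ->]: p %| q; last by rewrite rmorphM /= py mulr0.
  have [pq|pq'] := boolP (coprimep p q).
    have pqL : coprimep (map_poly (in_alg L) p) (map_poly (in_alg L) q).
      by rewrite coprimep_map.
    by have /eqP[] := coprimep_root pqL (introT eqP pz : root _ z).
  have /(_ pq')/eqp_dvdl <- := apply_irredp p_irr _ (dvdp_gcdl p q).
  exact: dvdp_gcdr.
have ex_q (x : L) : exists q, x == horner_alg z q.
  have /Fadjoin1P[q ->] : x \in <<1; z>>%VS by rewrite L_gen memvf.
  by exists q.
pose s (x : L) : B := horner_alg y (xchoose (ex_q x)).
have sE q : s (horner_alg z q) = horner_alg y q.
  apply/eqP; rewrite -subr_eq0 -rmorphB; apply/eqP/vanish.
  by rewrite rmorphB /=; apply/eqP; rewrite subr_eq0 eq_sym (xchooseP (ex_q _)).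
have s_zmod : zmod_morphism s.
  move=> x1 x2.
  have [/eqP-> /eqP->] := (xchooseP (ex_q x1), xchooseP (ex_q x2)).
  by rewrite -rmorphB !sE rmorphB.
have s_monoid : monoid_morphism s.
  split=> [|x1 x2]; first by rewrite -(rmorph1 (horner_alg z)) sE rmorph1.
  have [/eqP-> /eqP->] := (xchooseP (ex_q x1), xchooseP (ex_q x2)).
  by rewrite -rmorphM !sE rmorphM.
pose sM : {rmorphism L -> B} := HB.pack s
  (GRing.isZmodMorphism.Build _ _ s s_zmod)
  (GRing.isMonoidMorphism.Build _ _ s s_monoid).
by exists sM.
Qed.

End AlgebraGenerator.

(** * Cyclotomic fields *)

Lemma horner_alg_intr (F : fieldType) (B : algType F) (y : B) (p : {poly int}) :
  horner_alg y (map_poly intr p) = (map_poly intr p).[y].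
Proof.
rewrite /horner_alg /horner_morph -map_poly_comp; congr _.[_].
by apply: eq_map_poly => c /=; rewrite scaler_int.
Qed.

(** Additive maps between rational vector spaces are automatically linear, so a ring morphism
    preserves polynomial expressions with rational coefficients. *)
Lemma rmorph_horner_alg (A B : algType rat) (s : {rmorphism A -> B}) y p :
  s (horner_alg y p) = horner_alg (s y) p.
Proof.
rewrite !horner_algE rmorph_sum; apply: eq_bigr => i _ /=.
by rewrite (rat_linear (raddfB s)) -rmorphXn.
Qed.

Lemma size_quadratic (R : nzRingType) (c : R) :
  size ('X^2 - c *: 'X + 1 : {poly R}) = 3.
Proof.
rewrite -addrA size_polyDl size_polyXn //.
rewrite (leq_ltn_trans (size_polyD _ _)) // size_polyN size_poly1.
by rewrite gtn_max andbT (leq_ltn_trans (size_scale_leq _ _)) ?size_polyX.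
Qed.

Lemma prim_root_neq0 (F : fieldType) n (u : F) : n.-primitive_root u -> u != 0.
Proof.
move=> u_prim; apply: contra_eq_neq (prim_expr_order u_prim) => ->.
by rewrite expr0n (gtn_eqF (prim_order_gt0 u_prim)) eq_sym oner_eq0.
Qed.

Lemma prim_rootV (F : fieldType) n (u : F) :
  n.-primitive_root u -> n.-primitive_root u^-1.
Proof.
move=> u_prim; have n_gt0 := prim_order_gt0 u_prim.
have u_neq0 := prim_root_neq0 u_prim.
have -> : u^-1 = u ^+ n.-1.
  by apply: (mulfI u_neq0); rewrite mulfV // -exprS prednK ?prim_expr_order.
by rewrite prim_root_exp_coprime // coprimePn.
Qed.

Section CyclotomicField.
Variables (L : fieldExtType rat) (n : nat) (z : L).
Hypotheses (z_prim : n.-primitive_root z) (L_gen : <<1; z>>%VS = {:L}%VS).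
Local Notation Phi := (map_poly (intr : int -> rat) 'Phi_n).

Lemma prim_root_horner_Cyclotomic : horner_alg z Phi = 0.
Proof. by rewrite horner_alg_intr; apply/eqP/prim_root_Cyclotomic. Qed.

Lemma cyclotomic_lift (B : algType rat) (y : B) :
    (map_poly intr 'Phi_n).[y] = 0 ->
  exists s : {rmorphism L -> B}, forall q, s (horner_alg z q) = horner_alg y q.
Proof.
move=> y_root; apply: (generator_lift L_gen) => //.
- exact: irreducible_Cyclotomic (prim_order_gt0 z_prim).
- exact: prim_root_horner_Cyclotomic.
- by rewrite horner_alg_intr.
Qed.

(** The minimal polynomial of [z] has rational coefficients and divides the irreducible [Phi], hence
    has the same degree. *)
Lemma dim_cyclotomic : \dim {:L} = totient n.
Proof.
rewrite -L_gen dim_Fadjoin dimv1 muln1; apply: succn_inj.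
rewrite -size_minPoly -size_Cyclotomic.
have [p Dp] := polyOver1P (minPolyOver 1 z).
have p_dvd : p %| Phi.
  rewrite -(dvdp_map (in_alg L)) -Dp minPoly_dvdp //.
    by apply/polyOver1P; exists Phi.
  exact/eqP/prim_root_horner_Cyclotomic.
have size_p : size (minPoly 1 z) = size p.
  by rewrite Dp size_map_inj_poly ?rmorph0 //; apply: fmorph_inj.
have Phi_irr := irreducible_Cyclotomic (prim_order_gt0 z_prim).
rewrite size_p (eqp_size (apply_irredp Phi_irr _ p_dvd)).
  by rewrite size_map_inj_poly ?rmorph0 //; apply: intr_inj.
by rewrite -size_p neq_ltn size_minPoly orbT.
Qed.

Hypothesis n_gt2 : (2 < n)%N.

Lemma prim_root_inv_neq : z^-1 != z.
Proof.
have z_neq0 : z != 0 := prim_root_neq0 z_prim.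
apply: contraL n_gt2 => /eqP zV; rewrite -leqNgt dvdn_leq //.
by rewrite (prim_order_dvd z_prim) expr2 -{1}zV mulVf.
Qed.

(** The endomorphism of [L] sending [z] to [z^-1] fixes [z + z^-1], hence every polynomial in it,
    but moves [z] because [2 < n]. *)
Lemma notin_maximal_real : z \notin <<1; z + z^-1>>%VS.
Proof.
have [|s sE] := @cyclotomic_lift L z^-1.
  by apply/eqP; exact: prim_root_Cyclotomic (prim_rootV z_prim).
have sz : s z = z^-1.
  by have := sE 'X; rewrite !horner_algX.
apply/negP => /Fadjoin1P[q Dz].
have /eqP[] := prim_root_inv_neq; rewrite -sz {1}Dz.
by rewrite rmorph_horner_alg [RHS]Dz rmorphD fmorphV /= sz invrK addrC.
Qed.

(** [L] has degree exactly 2 over the subfield generated by [w]: at most 2 since [z] is a root of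
    ['X^2 - w *: 'X + 1], and not 1 since [z] lies outside. *)
Lemma dim_maximal_real : (\dim <<1; z + z^-1>>).*2 = totient n.
Proof.
have z_neq0 : z != 0 := prim_root_neq0 z_prim.
set w := z + z^-1; have z_notin := notin_maximal_real.
have gen : <<<<1; w>>; z>>%VS = {:L}%VS.
  by apply/eqP; rewrite eqEsubv subvf -L_gen adjoinSl // sub1v.
rewrite -dim_cyclotomic -gen (dim_Fadjoin <<1; w>>%AS) -mul2n; congr (_ * _)%N.
apply/eqP; rewrite eqn_leq andbC; apply/andP; split.
  rewrite -ltnS -size_minPoly.
  rewrite -[X in (_ <= X)%N](size_quadratic w).
  rewrite dvdp_leq -?size_poly_gt0 ?size_quadratic // minPoly_dvdp //.
    by rewrite rpredD ?rpred1 // rpredB ?rpredX ?polyOverX ?polyOverZ ?polyOverX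
               ?memv_adjoin.
  by rewrite rootE !hornerE /= mulrDl mulVf // expr2; apply/eqP; ring.
by rewrite ltn_neqAle /= andbT eq_sym adjoin_deg_eq1.
Qed.

End CyclotomicField.

(** * Nonscalar roots of a quadratic polynomial in an algebra *)

Section QuadraticElement.
Variables (F : fieldType) (A : algType F) (y : A) (t : F).
Hypothesis y_quad : y ^+ 2 = t *: y - 1.
Hypothesis y_nscalar : forall c : F, y != c%:A.
Local Notation g := ('X^2 - t *: 'X + 1 : {poly F}).

Let horner_g : horner_alg y g = 0.
Proof.
by rewrite rmorphD rmorphB rmorphXn rmorph1 /= linearZ /= horner_algX mulr_algl
           y_quad addrAC subrK subrr.
Qed.

Let size_g : size g = 3 := size_quadratic t.

(** The remainder modulo [g] has degree at most 1, and a nonzero one vanishing at [y] would make [y]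
    a scalar. *)
Lemma horner_alg_eq0 (p : {poly F}) : (horner_alg y p == 0) = (g %| p).
Proof.
apply/eqP/idP => [py | /dvdpP[q ->]]; last first.
  by rewrite rmorphM /= horner_g mulr0.
have g_neq0 : g != 0 by rewrite -size_poly_eq0 size_g.
apply/modp_eq0P; set r := (p %% g)%R.
have Dr : r = r`_1 *: 'X + (r`_0)%:P.
  have size_r : (size r <= 2)%N.
    by have := ltn_modp p g; rewrite g_neq0 size_g ltnS.
  apply/polyP => -[|[|i]]; rewrite coefD coefZ coefX coefC /= ?mulr0 ?add0r //.
    by rewrite mulr1 addr0.
  by rewrite nth_default // (leq_trans size_r).
have : horner_alg y r = 0.
  move: py; rewrite {1}(divp_eq p g) rmorphD rmorphM /= horner_g mulr0.
  by rewrite add0r.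
rewrite Dr rmorphD /= linearZ /= horner_algX horner_algC mulr_algl.
have [-> | r1] := eqVneq r`_1 0.
  rewrite scale0r add0r => /eqP; rewrite (fmorph_eq0 (in_alg A)) => /eqP->.
  by rewrite scale0r polyC0 addr0.
move/(canRL (addrK _)) => Dy; case/eqP: (y_nscalar ((r`_1)^-1 * - r`_0)).
by rewrite -scalerA scaleNr -[- _]add0r -Dy scalerA mulVf // scale1r.
Qed.

Lemma horner_alg_Xn_sub1 k : horner_alg y ('X^k - 1) = y ^+ k - 1.
Proof. by rewrite rmorphB rmorphXn rmorph1 /= horner_algX. Qed.

(** The algebra may have zero divisors, so a vanishing product of the values of the ['Phi_d] at [y]
    does not single out a factor. The argument instead takes place among polynomials over [F],
    through divisibility by [g]. *)
Lemma horner_Cyclotomic_quadratic n :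
    n%:R != 0 :> F -> (2 < n)%N -> y ^+ n = 1 ->
    (forall k, y ^+ k = 1 -> (n %| k)%N) ->
  horner_alg y (map_poly intr 'Phi_n) = 0.
Proof.
move=> nF n_gt2 yn y_ord; have n_gt0 : (0 < n)%N by apply: ltn_trans n_gt2.
have g_dvd : g %| 'X^n - 1.
  by rewrite -horner_alg_eq0 horner_alg_Xn_sub1 yn subrr.
have order_dvd d : (d %| n)%N -> g %| 'X^d - 1 -> d = n.
  rewrite -horner_alg_eq0 horner_alg_Xn_sub1 subr_eq0 => dn /eqP/y_ord nd.
  by apply/eqP; rewrite eqn_dvd dn nd.
apply/eqP; apply: contraT => Phi_neq0.
(* If g has a root u, then u and u^-1 are both primitive n-th roots of 1;
   otherwise g is irreducible and divides a single Phi_d. *)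
have no_root u : ~~ root g u.
  apply/negP => gu; have u_neq0 : u != 0.
    apply: contraTneq gu => ->.
    by rewrite rootE !hornerE expr0n subr0 add0r oner_eq0.
  have Dt : t = u + u^-1.
    apply: (mulIf u_neq0); rewrite mulrDl mulVf // -expr2.
    by move: gu; rewrite rootE !hornerE /= addrAC subr_eq0 => /eqP.
  have Dg : g = ('X - u%:P) * ('X - u^-1%:P).
    rewrite Dt -!mul_polyC polyCD mulrBl !mulrBr -polyCM mulfV // expr2.
    by ring.
  (* A double root would make a square divide ['X^n - 1], which is separable because [n] is nonzero
     in [F]. *)
  have uV : u != u^-1.
    apply: contraTneq g_dvd => uu; rewrite Dg -uu -expr2.
    rewrite (separable_nosquare (separable_Xn_sub_1 nF)) //.
    by rewrite size_XsubC.
  have g_dvdp p : root p u -> root p u^-1 -> g %| p.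
    rewrite Dg -!dvdp_XsubCl => pu puV; rewrite Gauss_dvdp ?pu //.
    by rewrite coprimep_XsubC2 // subr_eq0 eq_sym.
  have un : u ^+ n = 1.
    have: root ('X^n - 1) u.
      by rewrite -dvdp_XsubCl (dvdp_trans _ g_dvd) // Dg dvdp_mulr.
    by rewrite rootE !hornerE subr_eq0 => /eqP.
  have [d u_prim dn] := prim_order_exists n_gt0 un.
  have root_u (v : F) : d.-primitive_root v -> root ('X^d - 1) v.
    by move=> v_prim; rewrite rootE !hornerE (prim_expr_order v_prim) subrr.
  have uV_prim := prim_rootV u_prim.
  have Dd := order_dvd d dn (g_dvdp _ (root_u _ u_prim) (root_u _ uV_prim)).
  rewrite Dd in u_prim uV_prim; case/negP: Phi_neq0.
  by rewrite horner_alg_eq0 g_dvdp ?prim_root_Cyclotomic.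
have g_irr : irreducible_poly g by apply: cubic_irreducible; rewrite ?size_g.
have: ~~ coprimep g ('X^n - 1).
  apply/negP => /coprimepP/(_ g (dvdpp g) g_dvd).
  by rewrite -size_poly_eq1 size_g.
(* It suffices that [g] be coprime to each factor ['Phi_d]. Otherwise [g] divides ['Phi_d], hence
   ['X^d - 1], so that [d = n] by the order of [y], against [Phi_neq0]. *)
case/negP; rewrite -prod_Cyclotomic_map // big_seq.
apply: (big_ind (fun p => coprimep g p)) => [|p q gp gq|d].
- exact: coprimep1.
- by rewrite coprimepMr gp.
rewrite -dvdn_divisors // => dn; rewrite coprimep_def.
apply: contraNT Phi_neq0 => /(apply_irredp g_irr) /(_ (dvdp_gcdl _ _)) Dg.
have gd : g %| map_poly intr 'Phi_d by rewrite -(eqp_dvdl _ Dg) dvdp_gcdr.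
have d_gt0 := dvdn_gt0 n_gt0 dn.
rewrite -(order_dvd d dn) ?horner_alg_eq0 //.
exact: dvdp_trans gd (Cyclotomic_dvdp _ d_gt0 (dvdnn d)).
Qed.

End QuadraticElement.

(** * Ring morphisms between number fields *)

Lemma rat_ext_natr_eq0 (K : fieldExtType rat) n : (n%:R == 0 :> K) = (n == 0)%N.
Proof. by rewrite -(rmorph_nat (in_alg K)) fmorph_eq0 pnatr_eq0. Qed.

(** This turns a ring morphism into a linear map, making kernels, images and dimension counts
    available for it. *)
Lemma rat_rmorph_linfun (A B : falgType rat) (s : {rmorphism A -> B}) :
  exists h : 'Hom(A, B), h =1 s.
Proof.
have s_lin : linear s by move=> c u v; rewrite rmorphD (rat_linear (raddfB s)).
pose sL : {linear A -> B} := HB.pack (s : A -> B)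
  (GRing.isLinear.Build _ _ _ _ (s : A -> B) s_lin).
by exists (linfun sL) => u; rewrite lfunE.
Qed.

Lemma dim_limg_leq (F : fieldType) (U V : vectType F) (h : 'Hom(U, V))
    (W : {vspace U}) :
  (\dim (h @: W) <= \dim W)%N.
Proof. by rewrite -[leqRHS](limg_ker_dim h W) leq_addl. Qed.

Lemma rmorph_dim_leq (K1 K2 : fieldExtType rat) (s : {rmorphism K1 -> K2}) :
  (\dim {:K1} <= \dim {:K2})%N.
Proof.
have [h hE] := rat_rmorph_linfun s.
have h_inj : lker h == 0%VS.
  by apply/lker0P => u v; rewrite !hE; apply: fmorph_inj.
rewrite -(limg_dim_eq (f := h)) ?dimvS ?subvf //.
by apply/eqP; rewrite (eqP h_inj) capv0.
Qed.

Lemma field_isomorphic_rmorph (K1 K2 : fieldType) :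
  field_isomorphic K1 K2 -> exists s : {rmorphism K2 -> K1}, bijective s.
Proof.
case=> f [g fK gK].
pose gM : {rmorphism K2 -> K1} := HB.pack g
  (GRing.isZmodMorphism.Build _ _ g (can2_zmod_morphism fK gK))
  (GRing.isMonoidMorphism.Build _ _ g (can2_monoid_morphism fK gK)).
by exists gM; exists f.
Qed.

Lemma field_isomorphic_dim (K1 K2 : fieldExtType rat) :
  field_isomorphic K1 K2 -> \dim {:K1} = \dim {:K2}.
Proof.
move=> iso; apply/eqP; rewrite eqn_leq; case: (iso) => f _.
have [g _] := field_isomorphic_rmorph iso.
by rewrite (rmorph_dim_leq f) (rmorph_dim_leq g).
Qed.

Lemma rmorph_dim_bij (K1 K2 : fieldExtType rat) (s : {rmorphism K1 -> K2}) :
  \dim {:K1} = \dim {:K2} -> bijective s.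
Proof.
move=> eq_dim; have [h hE] := rat_rmorph_linfun s.
have h_inj : lker h == 0%VS.
  by apply/lker0P => u v; rewrite !hE; apply: fmorph_inj.
have h_img : limg h = fullv.
  have h_cap : (fullv :&: lker h)%VS = 0%VS by rewrite (eqP h_inj) capv0.
  by apply/eqP; rewrite eqEdim subvf (limg_dim_eq h_cap) eq_dim leqnn.
exists (h^-1)%VF => u; first by rewrite -hE lker0_lfunK.
by rewrite -hE limg_lfunVK // h_img memvf.
Qed.

(** A vector is kept exactly when it lies outside the span of those after it. *)
Lemma exists_subbasis (F : fieldType) (V : vectType F) (X : seq V) :
  exists2 Y : seq V, basis_of <<X>> Y & {subset Y <= X}.
Proof.
elim: X => [|v X [Y /andP[/eqP Yspan Yfree] sYX]].
  by exists [::]; rewrite // /basis_of eqxx nil_free.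
have [vX | vX] := boolP (v \in <<X>>%VS).
  exists Y => [|u /sYX]; last by rewrite inE => ->; rewrite orbT.
  rewrite /basis_of Yfree andbT Yspan span_cons eq_sym.
  by apply/eqP/addv_idPr; rewrite -memvE.
exists (v :: Y) => [|u]; last first.
  by rewrite !inE => /orP[-> // | /sYX ->]; rewrite orbT.
by rewrite /basis_of !span_cons Yspan eqxx free_cons Yspan vX.
Qed.

(** * The binary dihedral group *)

Section BinaryDihedral.
Local Open Scope group_scope.

Section Model.
Variables (m : nat) (m_gt0 : (0 < m)%N).
Local Notation n := (2 * m)%N.
Local Notation T := ('Z_n * bool)%type.

Let n_gt1 : (1 < n)%N.
Proof. lia. Qed.

Let m2 : (m%:R + m%:R = 0 :> 'Z_n)%R.
Proof. by rewrite -natrD addnn -mul2n pchar_Zp. Qed.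

(* The left regular representation: (k, b) stands for y^k x^b, so that
   x y^k = y^-k x and x y^k x = y^(m - k). *)
Definition dicyclic_y_fun (u : T) : T := (u.1 + 1, u.2)%R.
Definition dicyclic_x_fun (u : T) : T :=
  (if u.2 then m%:R - u.1 else - u.1, ~~ u.2)%R.

Lemma dicyclic_y_inj : injective dicyclic_y_fun.
Proof.
case=> k b [k' b'] e; have /addIr/= -> := congr1 fst e.
by have /= -> := congr1 snd e.
Qed.

Lemma dicyclic_x_inj : injective dicyclic_x_fun.
Proof.
case=> k b [k' b'] e; have /= /negb_inj Db := congr1 snd e.
have /= := congr1 fst e; rewrite -{}Db.
by case: b {e} => [/addrI|] /oppr_inj->.
Qed.

Definition dicyclic_y := perm dicyclic_y_inj.
Definition dicyclic_x := perm dicyclic_x_inj.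

Lemma dicyclic_yX i (u : T) : (dicyclic_y ^+ i) u = (u.1 + i%:R, u.2)%R.
Proof.
elim: i u => [|i IHi] [k b]; first by rewrite expg0 perm1 addr0.
by rewrite expgSr permM IHi permE /dicyclic_y_fun /= -addrA natr1.
Qed.

Lemma dicyclic_homg :
  <[dicyclic_x]> <*> <[dicyclic_y]> \homg Grp (x : y : y ^+ (2 * m) = 1,
    x ^+ 2 = y ^+ m, x * y * x^-1 = y^-1).
Proof.
apply/existsP; exists (dicyclic_x, dicyclic_y); rewrite /= !xpair_eqE eqxx /=.
apply/and3P; split.
- by apply/eqP/permP => -[k b]; rewrite dicyclic_yX perm1 pchar_Zp // addr0.
- apply/eqP/permP => -[k b]; rewrite dicyclic_yX expgS expg1 permM !permE.
  have mN : (- m%:R = m%:R :> 'Z_n)%R.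
    by apply/eqP; rewrite eq_sym -addr_eq0 m2.
  rewrite /dicyclic_x_fun /=.
  by case: b => /=; congr (_, _); rewrite ?opprB ?opprK ?mN // addrC.
(* The relation is checked in the inverse-free form [y * (x * y) = x]. *)
apply/eqP/(canLR (mulgK _))/(mulgI dicyclic_y); rewrite mulKVg.
apply/permP => -[k b]; rewrite !permM !permE.
rewrite /dicyclic_y_fun /dicyclic_x_fun /=.
by case: b => /=; congr (_, _); rewrite opprD ?addrA subrK.
Qed.

Lemma order_dicyclic_y : #[dicyclic_y] = n.
Proof.
apply/eqP; rewrite eqn_dvd order_dvdn; apply/andP; split.
  by apply/eqP/permP => -[k b]; rewrite dicyclic_yX perm1 pchar_Zp // addr0.
have /permP/(_ (0%R, false)) := expg_order dicyclic_y.
rewrite dicyclic_yX perm1 add0r => /(congr1 fst)/(congr1 val) /=.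
by rewrite val_Zp_nat // => /eqP.
Qed.

(** Powers of [dicyclic_y] fix the boolean component and [dicyclic_x] flips it, so the cyclic group
    of order [2 * m] has index at least 2. This is what shows that the presentation does not
    collapse. *)
Lemma card_dicyclic : (4 * m <= #|<[dicyclic_x]> <*> <[dicyclic_y]>|)%N.
Proof.
rewrite -(Lagrange (joing_subr <[dicyclic_x]> <[dicyclic_y]>)) -orderE.
rewrite order_dicyclic_y [leqRHS]mulnC -(mulnA 2 2) leq_mul2r indexg_gt1.
rewrite join_subG subxx andbT cycle_subG orbC.
apply/orP; left; apply/cycleP => -[i].
by move/permP/(_ (0%R, false)); rewrite dicyclic_yX permE => /(congr1 snd).
Qed.

End Model.

(** The relations give [G] as the union of two cosets of [<[y]>], and the order of [y] divides
    [2 * m]. As [G] maps onto the permutation model, it has at least [4 * m] elements, which forces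
    equality. *)
Lemma binary_dihedral_gen m (gT : finGroupType) (G : {group gT}) :
    (0 < m)%N -> binary_dihedral m G ->
  exists x y, [/\ x \in G, y \in G, #[y] = (2 * m)%N, x * y * x^-1 = y^-1
    & forall g, g \in G -> exists k, g = y ^+ k \/ g = x * y ^+ k].
Proof.
move=> m_gt0 G_bd; have /existsP[[x y] /=] := isoGrp_hom G_bd.
rewrite /= !xpair_eqE => /and4P[/eqP DG /eqP yn /eqP x2 /eqP xy].
have xG : x \in G by rewrite -DG mem_gen // inE cycle_id.
have yG : y \in G by rewrite -DG mem_gen // inE cycle_id orbT.
have nyx : <[x]> \subset 'N(<[y]>).
  rewrite cycle_subG -groupV; apply/normP.
  by rewrite -cycleJ conjgE invgK mulgA xy cycleV.
have Gxy g : g \in G -> exists k, g = y ^+ k \/ g = x * y ^+ k.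
  rewrite -DG norm_joinEl // => /mulsgP[_ _ /cycleP[i ->] /cycleP[j ->] ->].
  (* In [x ^+ i * y ^+ j], each pair of factors [x] is traded for [y ^+ m]. *)
  exists (m * i./2 + j)%N; rewrite -{1 3}(odd_double_half i) expgD -mul2n.
  by rewrite [x ^+ (2 * _)]expgM x2 -expgM -mulgA -expgD;
     case: (odd i); [right | left]; rewrite ?mul1g.
exists x, y; split=> //; apply/eqP.
rewrite eqn_leq dvdn_leq ?muln_gt0 // ?order_dvdn ?yn //=.
have oG : (4 * m <= #|G|)%N.
  apply: leq_trans (card_dicyclic m_gt0) (dvdn_leq (cardG_gt0 G) _).
  by apply: card_homg; rewrite G_bd dicyclic_homg.
rewrite -(leq_pmul2l (isT : (0 < 2)%N)) mulnA; apply: leq_trans oG _.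
rewrite mul2n -addnn orderE -{2}(card_lcoset <[y]> x).
apply: leq_trans (leq_card_setU _ _); apply: subset_leq_card.
apply/subsetP => g /Gxy[k [] ->]; rewrite inE ?mem_cycle //.
by rewrite mem_lcoset mulKg mem_cycle orbT.
Qed.

End BinaryDihedral.

(** * Dicyclic generators of a quaternion algebra *)

Section Dicyclic.
Variables (K : fieldExtType rat) (a b : K).
Local Notation A := (quat a b).
Local Notation B := (restr A).
Variables (n : nat) (n_gt2 : (2 < n)%N) (x x' y y' : A) (t : K).
Hypotheses (x'K : x' * x = 1) (yK : y * y' = 1) (y'K : y' * y = 1).
Hypotheses (xy : x * y = y' * x) (y_trace : y + y' = t%:A).
Hypotheses (yn : y ^+ n = 1) (y_ord : forall k, y ^+ k = 1 -> (n %| k)%N).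

Let mulxI : injective ( *%R x).
Proof. by apply: (can_inj (g := *%R x')) => u; rewrite mulrA x'K mul1r. Qed.

Let yy' : y' != y.
Proof.
apply: contraL n_gt2 => /eqP Dy; rewrite -leqNgt dvdn_leq //.
by apply: y_ord; rewrite expr2 -{1}Dy.
Qed.

Let yx : y * x = x * y'.
Proof.
by rewrite -[LHS]mulr1 -yK mulrA -(mulrA y) xy (mulrA y) yK mul1r.
Qed.

Let y_nscalar (c : K) : y != c%:A.
Proof.
(* A scalar [y] would commute with [x], whereas [y * x = x * y'] with [y'] distinct from [y]. *)
apply: contraNneq yy' => Dy; apply/eqP/mulxI.
by rewrite -yx Dy mulr_algl mulr_algr.
Qed.

Variables (L : fieldExtType rat) (z : L).
Hypotheses (z_prim : n.-primitive_root z) (L_gen : <<1; z>>%VS = {:L}%VS).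
Local Notation w := (z + z^-1).

(** The second clause serves to write elements of the image as rational combinations of powers of
    [y]. *)
Lemma dicyclic_lift : exists s : {rmorphism L -> B},
  s z = y /\ forall l, exists q, s l = horner_alg (y : B) q.
Proof.
have y_quad : y ^+ 2 = t *: y - 1.
  by apply/(canRL (addrK _)); rewrite -y'K expr2 -mulrDl y_trace mulr_algl.
have nK : n%:R != 0 :> K by rewrite rat_ext_natr_eq0 -lt0n (ltn_trans _ n_gt2).
have := horner_Cyclotomic_quadratic y_quad y_nscalar nK n_gt2 yn y_ord.
rewrite horner_alg_intr => y_root.
have [s sE] := @cyclotomic_lift L n z z_prim L_gen B y y_root.
exists s; split=> [|l]; first by have := sE 'X; rewrite !horner_algX.
have /Fadjoin1P[q ->] : l \in <<1; z>>%VS by rewrite L_gen memvf.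
by exists q.
Qed.

Variable s : {rmorphism L -> B}.
Hypothesis s_z : s z = y.

Let s_zV : s z^-1 = y'.
Proof.
have z_neq0 := prim_root_neq0 z_prim.
have : s (z^-1 * z) * y' = y' by rewrite mulVf // rmorph1 mul1r.
by rewrite rmorphM s_z -mulrA yK mulr1.
Qed.

(** [s] sends [w] to the scalar [y + y'], hence polynomials in [w] to scalars, whose value is read
    off by [q0]. *)
Lemma maximal_real_lift : exists r : {rmorphism subvs_of <<1; w>>%AS -> K},
  forall u, s (vsval u) = (r u)%:A :> A.
Proof.
pose r (u : subvs_of <<1; w>>%AS) : K := q0 (s (vsval u) : A).
have q0A (c : K) : q0 (c%:A : A) = c by rewrite /= mulr1.
have rE u : s (vsval u) = (r u)%:A :> A.
  rewrite /r; have /Fadjoin1P[q ->] := subvsP u.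
  rewrite rmorph_horner_alg rmorphD s_z s_zV.
  have -> : y + y' = t%:A :> B := y_trace.
  by rewrite -(@rmorph_horner_alg K B (in_alg A : {rmorphism K -> A}) t q) q0A.
have r_zmod : zmod_morphism r by move=> u v; rewrite /r !rmorphB.
have r_monoid : monoid_morphism r.
  split=> [|u v]; first by rewrite /r !rmorph1.
  have ruv : s (vsval (u * v)) = (r u)%:A * (r v)%:A :> A.
    by rewrite !rmorphM -!rE.
  by rewrite {1}/r ruv mulr_algl scalerA q0A.
pose rM : {rmorphism subvs_of <<1; w>>%AS -> K} := HB.pack r
  (GRing.isZmodMorphism.Build _ _ r r_zmod)
  (GRing.isMonoidMorphism.Build _ _ r r_monoid).
by exists rM.
Qed.

(** The elements [1], [y], [x], [x * y] form a basis over [K], and bijectivity of [r] puts all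
    scalars in the image of [s]. *)
Lemma dicyclic_generation (r : {rmorphism subvs_of <<1; w>>%AS -> K}) :
    (forall u, s (vsval u) = (r u)%:A :> A) -> bijective r ->
  forall v : A, exists l1 l2, v = (s l1 : A) + x * (s l2 : A).
Proof.
move=> rE [r' _ rK] v.
(* The coordinates of [u] merely serve as four coefficients in [K]. Injectivity of this endomorphism
   is the independence of [1], [y], [x], [x * y], and implies surjectivity by finite dimension. *)
pose phi (u : A) : A := q0 u *: 1 + q1 u *: y + x * (q2 u *: 1 + q3 u *: y).
have phi_lin : linear phi.
  have lin2 (c c1 c2 d1 d2 : K) :
      (c * c1 + d1) *: 1 + (c * c2 + d2) *: y
    = c *: (c1 *: 1 + c2 *: y) + (d1 *: 1 + d2 *: y).
    by rewrite !scalerDl scalerDr !scalerA addrACA.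
  by move=> c u u'; rewrite /phi /= !lin2 mulrDr -scalerAr addrACA -scalerDr.
pose phiL : {linear A -> A} := HB.pack phi
  (GRing.isLinear.Build _ _ _ _ phi phi_lin).
pose h := linfun phiL.
have h_inj : lker h == 0%VS.
  apply/lker0P => u u'; rewrite !lfunE => /eqP.
  rewrite -subr_eq0 -raddfB => /eqP e; apply/eqP; rewrite -subr_eq0; apply/eqP.
  move: (u - u') e => d /=; rewrite /phi.
  set p := q0 d *: 1 + _; set q := q2 d *: 1 + _ => pq0.
  have comm_y c1 c2 : y * (c1 *: 1 + c2 *: y) = (c1 *: 1 + c2 *: y) * y.
    by rewrite mulrDl mulrDr -!scalerAl -!scalerAr mul1r mulr1.
  have indep (c1 c2 : K) : c1 *: 1 + c2 *: y = 0 :> A -> c1 = 0 /\ c2 = 0.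
    have [-> | c2_neq0] := eqVneq c2 0.
      rewrite scale0r addr0 => /eqP; rewrite scaler_eq0 oner_eq0 orbF.
      by move/eqP.
    rewrite addrC => /(canRL (addrK _)) Dy.
    case/eqP: (y_nscalar (c2^-1 * - c1)).
    by rewrite -scalerA scaleNr -[- _]add0r -Dy scalerA mulVf // scale1r.
  have q_eq0 : q = 0.
    have e1 : x * ((y' - y) * q) = 0.
      have : y * (p + x * q) - (p + x * q) * y = 0.
        by rewrite pq0 mulr0 mul0r subrr.
      rewrite mulrDl mulrDr comm_y opprD addrACA subrr add0r mulrA yx.
      by rewrite -!mulrA -comm_y -mulrBr -mulrBl.
    have e2 : (y' - y) * q = 0 by apply: mulxI; rewrite e1 mulr0.
    (* [y' - y] is the image under [s] of a nonzero element of the field [L], so it can be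
       cancelled. *)
    have zVz : z^-1 - z != 0 by rewrite subr_eq0 (prim_root_inv_neq z_prim).
    have : s ((z^-1 - z)^-1 * (z^-1 - z)) * (q : B) = q :> B.
      by rewrite mulVf // rmorph1 mul1r.
    rewrite rmorphM -mulrA rmorphB s_z s_zV => <-.
    by rewrite [X in _ * X]e2 mulr0.
  move: pq0; rewrite q_eq0 mulr0 addr0.
  case/indep => d0 d1; have [d2 d3] := indep _ _ q_eq0.
  by case: d d0 d1 d2 d3 {p q q_eq0} => ? ? ? ? /= -> -> -> ->.
have /memv_imgP[c _ ->] : v \in limg h by rewrite lker0_limgf ?memvf.
rewrite lfunE /= /phi.
pose l c := vsval (r' c).
have lE c' : c'%:A = s (l c') :> A by rewrite rE rK.
exists (l (q0 c) + l (q1 c) * z), (l (q2 c) + l (q3 c) * z).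
have sE c1 c2 : s (l c1 + l c2 * z) = c1 *: 1 + c2 *: y :> A.
  by rewrite -[c2 *: y]mulr_algl !lE rmorphD rmorphM s_z.
by rewrite !sE.
Qed.

End Dicyclic.

(** * Dimension, norm and trace of quaternions, and the two equivalences *)

Lemma dim_restr_quat (K : fieldExtType rat) (a b : K) :
  \dim {:restr (quat a b)} = (4 * \dim {:K})%N.
Proof. by rewrite !dimvf. Qed.

Lemma q_norm1_conj (F : fieldType) (a b : F) (u : quat a b) :
  q_norm u = 1 -> u * q_conj u = 1.
Proof. by move=> Nu; rewrite q_mul_conj Nu scale1r. Qed.

Lemma q_conj_trace (F : fieldType) (a b : F) (u : quat a b) :
  u + q_conj u = (q0 u *+ 2)%:A.
Proof.
by case: u => *; congr Quat; rewrite /= ?subrr ?mulr1 ?mulr0 ?mulr2n.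
Qed.

Theorem theorem3p2p11 (R : realType) (K : fieldExtType rat) (n : nat)
  (Kn : \dim {:K} = n) (K_real : totally_real R K)
  (a b : K) (a_neq0 : a != 0) (b_neq0 : b != 0)
  (A_def : totally_definite R (quat a b))
  (Lam : {pred quat a b}) (Lam_order : is_order Lam)
  (m : nat) (m_gt1 : (1 < m)%N)
  (gT : finGroupType) (G : {group gT}) (G_bd : binary_dihedral m G)
  (Lam1_G : mul_isog (norm_one Lam) G)
  (* L is the cyclotomic field Q(zeta_{2m}) *)
  (L : fieldExtType rat) (z : L) (z_prim : (2 * m)%N.-primitive_root z)
  (L_gen : <<1; z>>%VS = {:L}%VS) :
  (contains_rat_basis (norm_one Lam) <->
     field_isomorphic K (subvs_of <<1; z + z^-1>>%AS)) /\
  (field_isomorphic K (subvs_of <<1; z + z^-1>>%AS) <->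
     totient (2 * m) = (2 * n)%N).
Proof.
have m2_gt2 : (2 < 2 * m)%N by rewrite -[X in (X < _)%N]muln1 ltn_pmul2l.
have [f [fM f_inj fP]] := Lam1_G.
have f_norm g : g \in G -> q_norm (f g) = 1.
  by move=> gG; have /andP[_ /eqP] : f g \in norm_one Lam by apply/fP; exists g.
(* [f] is only known to be multiplicative on [G]; [f 1%g] is an idempotent of norm 1, hence
   invertible, hence 1. *)
have f1 : f 1%g = 1.
  have Nf1 := q_norm1_conj (f_norm _ (group1 G)).
  by rewrite -[LHS]mulr1 -Nf1 mulrA -fM // mulg1.
have fX g k : g \in G -> f (g ^+ k)%g = f g ^+ k.
  move=> gG; elim: k => [|k IHk]; first by rewrite f1.
  by rewrite expgS exprS fM ?groupX // IHk.
have [gx [gy [gxG gyG gy_order gxy G_gen]]] :=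
  binary_dihedral_gen (ltnW m_gt1) G_bd.
pose x := f gx; pose y := f gy; pose y' := f gy^-1%g.
have x'K : f gx^-1%g * x = 1 by rewrite -fM ?groupV // mulVg.
have yK : y * y' = 1 by rewrite -fM ?groupV // mulgV.
have y'K : y' * y = 1 by rewrite -fM ?groupV // mulVg.
have xy : x * y = y' * x.
  by rewrite -!fM ?groupV //; congr f; rewrite -gxy mulgKV.
(* Norm 1 identifies the inverse [y'] with the conjugate of [y], so that the sum is the reduced
   trace. *)
have y_trace : y + y' = (q0 y *+ 2)%:A.
  rewrite -q_conj_trace; congr (_ + _).
  by rewrite -[LHS]mulr1 -(q_norm1_conj (f_norm _ gyG)) mulrA y'K mul1r.
have yn : y ^+ (2 * m) = 1 by rewrite -fX // -gy_order expg_order f1.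
have y_ord k : y ^+ k = 1 -> (2 * m %| k)%N.
  move=> yk; rewrite -gy_order order_dvdn; apply/eqP/f_inj; rewrite ?groupX //.
  by rewrite fX // f1.
have [s [s_z s_range]] :=
  dicyclic_lift m2_gt2 x'K yK y'K xy y_trace yn y_ord z_prim L_gen.
have [r rE] := maximal_real_lift yK y_trace z_prim s_z.
set w := z + z^-1 in r rE *.
have dim_L : \dim {:L} = totient (2 * m) := dim_cyclotomic z_prim L_gen.
have dim_w : (\dim {:subvs_of <<1; w>>}).*2 = totient (2 * m).
  by rewrite -(dim_maximal_real z_prim L_gen m2_gt2) dimvf.
have iso_dim : field_isomorphic K (subvs_of <<1; w>>%AS) <->
    totient (2 * m) = (2 * n)%N.
  split=> [/field_isomorphic_dim | ].
    by rewrite -dim_w Kn => ->; rewrite mul2n.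
  rewrite -dim_w mul2n => /double_inj dim_wn.
  apply: field_isomorphic_rmorph; exists r.
  by apply: rmorph_dim_bij; rewrite dim_wn.
split=> //; rewrite iso_dim; split=> [[X /andP[/eqP X_span _] sXLam] | dim_n].
  (* The embedding [r] gives this inequality; the bound on the span of [X] by the images of [s] and
     of [x] times [s] gives the reverse one. *)
  have r_dim : (totient (2 * m) <= n.*2)%N.
    by rewrite -dim_w leq_double -Kn; apply: rmorph_dim_leq r.
  have [h hE] := rat_rmorph_linfun s.
  pose hx := (amull (x : restr (quat a b)) \o h)%VF.
  have X_sub : (<<X>> <= limg h + limg hx)%VS.
    apply/span_subvP => v /sXLam/fP[g gG <-]; have [k] := G_gen g gG.
    have h_z : h (z ^+ k) = y ^+ k by rewrite hE rmorphXn s_z.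
    case=> ->; rewrite ?fM ?groupX // fX //.
      by apply: (subvP (addvSl _ _)); rewrite -h_z memv_img ?memvf.
    apply: (subvP (addvSr _ _)); rewrite -h_z.
    have -> : x * h (z ^+ k) = hx (z ^+ k) by rewrite comp_lfunE lfunE.
    by rewrite memv_img ?memvf.
  have : (4 * n <= totient (2 * m) + totient (2 * m))%N.
    rewrite -Kn -(dim_restr_quat a b) -X_span -dim_L.
    apply: leq_trans (dimvS X_sub) _.
    apply: leq_trans (leq_of_leqif (dimv_add_leqif _ _)) _.
    by rewrite leq_add ?dim_limg_leq.
  lia.
pose S := [seq f g | g <- enum G] : seq (restr (quat a b)).
have S_full : <<S>>%VS = fullv.
  have r_bij : bijective r.
    by apply: rmorph_dim_bij; apply/double_inj; rewrite dim_w dim_n Kn mul2n.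
  apply/eqP; rewrite eqEsubv subvf; apply/subvP => v _.
  have fS g : g \in G -> (f g : restr (quat a b)) \in <<S>>%VS.
    by move=> gG; rewrite memv_span // map_f // mem_enum.
  have [l1 [l2 ->]] :=
    dicyclic_generation m2_gt2 x'K yK y'K xy y_ord z_prim s_z rE r_bij v.
  (* Expanding both polynomials leaves rational combinations of the group elements [y ^+ i] and
     [x * y ^+ i]. *)
  have [q1 ->] := s_range l1; have [q2 ->] := s_range l2.
  rewrite !horner_algE memvD //.
    apply: memv_suml => i _; rewrite memvZ //.
    by rewrite -fX // fS ?groupX.
  rewrite mulr_sumr; apply: memv_suml => i _; rewrite -scalerAr memvZ //.
  by rewrite -fX // -fM ?groupX // fS ?groupM ?groupX.
have [X X_basis sXS] := exists_subbasis S.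
exists X => [|v /sXS/mapP[g gG ->]]; first by rewrite -S_full.
by apply/fP; exists g; rewrite // -mem_enum.
Qed.
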